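(* Let $L$ be one of the following three languages: the language $\{u\in\{0,1\}^+\mid u=u^R\}$ of binary palindromes; the binary copy-language $\{ww\mid w\in\{0,1\}^*\}$; or the language consisting of all binary Lyndon words with respect to $0<1$ together with all words obtained from them by exchanging $0$ and $1$. Then each graph of order $n$ can be $L$-represented by a word that can be written with $\mathcal O(n^2\log n)$ bits. The analogous statement holds when $L$ is replaced by its complement $\{0,1\}^*\setminus L$.
   Context: Writing a single letter of an alphabet $V$ takes $\mathcal O(\log|V|)$ bits, so a word $w\in V^*$ is written with $\mathcal O(|w|\log|V|)$ bits. The order of a graph is its number of vertices. $u^R$ is the reversal of $u$. A word is primitive if it is not of the form $u^k$ with $k\ge2$; a Lyndon word is a primitive word that is lexicographically smallest among its conjugates (the conjugates of $uv$ are the words $vu$). Graphs are finite, undirected and simple: $G=(V,E)$ with $V$ a finite non-empty set and $E\subseteq\binom{V}{2}$. A language $L\subseteq\{0,1\}^*$ is $0$-$1$-symmetric if it is invariant under the morphism exchanging $0$ and $1$ (the languages here are). For distinct letters $u,v$ of an alphabet $V$, $h_{u,v}:V^*\to\{0,1\}^*$ is the monoid morphism with $u\mapsto 0$, $v\mapsto 1$, and $x\mapsto\lambda$ (empty word) for all other letters $x$. For a $0$-$1$-symmetric $L$ and a word $w\in V^*$ in which every letter of $V$ occurs, $G(L,w)$ is the graph with vertex set $V$ in which distinct $u,v$ are adjacent if and only if $h_{u,v}(w)\in L$. A graph $G=(V,E)$ is $L$-represented by $w\in V^*$ if every letter of $V$ occurs in $w$ and $G=G(L,w)$. *)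

(* Defs.v *)
From HB Require Import structures.
From mathcomp Require Import all_boot all_order all_algebra.
From mathcomp Require Import all_classical all_reals all_analysis.

Set Implicit Arguments.
Unset Strict Implicit.
Unset Printing Implicit Defensive.

Import Order.TTheory GRing.Theory Num.Theory.
Import numFieldNormedType.Exports.

Local Open Scope classical_set_scope.
Local Open Scope ring_scope.

(* Binary words are sequences of booleans, with 0 encoded as false and 1 as
   true, so that exchanging 0 and 1 is letterwise negation. *)
Definition binword := seq bool.
Definition language := set binword.

Definition exchange (u : binword) : binword := [seq ~~ b | b <- u].

Definition palindromes : language := [set u | u <> [::] /\ u = rev u].

Definition copy_language : language := [set w ++ w | w in [set: binword]].

Definition wpow (u : binword) (k : nat) : binword := flatten (nseq k u).

(* The empty word is a square of itself, hence not primitive. *)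
Definition primitive (u : binword) : Prop :=
  ~ exists (x : binword) (k : nat), (2 <= k)%N /\ u = wpow x k.

Definition conjugate (u u' : binword) : Prop :=
  exists x y : binword, u = x ++ y /\ u' = y ++ x.

(* The order instance on bool has false < true, i.e. 0 < 1. *)
Definition lex_le (u v : binword) : bool :=
  ((u : seqlexi bool) <= (v : seqlexi bool))%O.

Definition lyndon : language :=
  [set u | primitive u /\ forall u', conjugate u u' -> lex_le u u'].

Definition lyndon_language : language := lyndon `|` exchange @` lyndon.

Record graph (V : finType) := Graph {
  adj : rel V;
  adj_sym : symmetric adj;
  adj_irr : irreflexive adj
}.

(* The morphism V^* -> {0,1}^* with u |-> 0, v |-> 1 and x |-> empty word
   for every other letter x; it is used only for u != v. *)
Definition proj (V : finType) (u v : V) (w : seq V) : binword :=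
  flatten [seq if x == u then [:: false]
               else if x == v then [:: true] else [::] | x <- w].

(* Adjacency in the graph G(L, w); it is symmetric in u and v when L is
   invariant under exchange. *)
Definition word_adj (V : finType) (L : language) (w : seq V) (u v : V) : Prop :=
  u != v /\ L (proj u v w).

Definition represents (V : finType) (L : language) (w : seq V) (G : graph V) :
    Prop :=
  (forall x : V, x \in w) /\ (forall u v : V, adj G u v <-> word_adj L w u v).

(* Length of w under a fixed-length binary code for V, which takes
   ceil(log_2 |V|) bits per letter. *)
Definition bit_length (V : finType) (w : seq V) : nat :=
  (size w * up_log 2 #|V|)%N.

(* Each graph of order n is L-represented by a word that can be written with
   O(g n) bits. The bound f is uniform over all graphs of a given order, and
   every graph is represented: only the estimate of f is asymptotic. *)
Definition graphs_representable_in_bits (R : realType) (L : language)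
    (g : nat -> R) : Prop :=
  exists2 f : nat -> nat,
    (fun n => (f n)%:R : R) =O_\oo g &
    forall (V : finType) (G : graph V), (0 < #|V|)%N ->
      exists2 w : seq V, represents L w G & (bit_length w <= f #|V|)%N.

(* Main.v *)
(** Since [G(~L, w)] is the complement graph of [G(L, w)], it suffices to
    represent all graphs with [L] itself.

    For palindromes and copies, put [A = prod_i (i N_i)] and
    [B = prod_i (N_i i)], where [N_i] lists the non-neighbours of [i].  The
    blocks of [h_{u,v}(A)] and [h_{u,v}(B)] have equal lengths, agree when [u]
    and [v] are adjacent, and differ in block [u] otherwise.  So [A B^R] is an
    encoding by palindromes and [A B] an encoding by copies.

    For Lyndon words, let [pi] list [V], let [R_i] list the neighbours of [i]
    and take [prod_i i^4 . prod_i (i^3 R_i i^2 N_i pi)].  If [u] precedes [v]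
    in [pi], the projection starts with [0^4 1] and ends with [1].  When [u]
    and [v] are adjacent it contains no other [0^4], hence is a Lyndon word;
    otherwise block [u] contributes [0^5], hence a smaller conjugate. *)
Require Import Defs.
From HB Require Import structures.
From mathcomp Require Import all_boot all_order all_algebra.
From mathcomp Require Import all_classical all_reals all_analysis.
From mathcomp Require Import zify ring.

Set Implicit Arguments.
Unset Strict Implicit.
Unset Printing Implicit Defensive.

Import Order.TTheory GRing.Theory Num.Theory.
Import numFieldNormedType.Exports.

Local Open Scope classical_set_scope.
Local Open Scope ring_scope.

(* [mathcomp-analysis] also exports a [proj]. *)
Local Notation proj := Defs.proj.

(** * Projections onto two letters *)

Section Projection.
Variables (V : finType) (u v : V).
Implicit Types s t : seq V.

Lemma proj_cat s t : proj u v (s ++ t) = proj u v s ++ proj u v t.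
Proof. by rewrite /proj map_cat flatten_cat. Qed.

Lemma proj_flatten (ss : seq (seq V)) :
  proj u v (flatten ss) = flatten [seq proj u v s | s <- ss].
Proof. by elim: ss => //= s ss IH; rewrite proj_cat IH. Qed.

Lemma proj_rev s : proj u v (rev s) = rev (proj u v s).
Proof.
elim: s => // x s IH; rewrite rev_cons -cats1 proj_cat IH.
rewrite -cat1s (proj_cat [:: x]) rev_cat; congr (_ ++ _).
by rewrite /proj /=; case: eqP => // _; case: eqP.
Qed.

Lemma proj_notin_l s : u \notin s -> proj u v s = nseq (count_mem v s) true.
Proof.
elim: s => //= x s IH; rewrite inE negb_or eq_sym => /andP[/negPf xu /IH].
by rewrite /proj /= xu => ->; case: eqP.
Qed.

Lemma proj_notin_r s : v \notin s -> proj u v s = nseq (count_mem u s) false.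
Proof.
elim: s => //= x s IH; rewrite inE negb_or eq_sym => /andP[/negPf xv /IH].
by rewrite /proj /= xv => ->; case: eqP.
Qed.

Lemma proj_nseq_l k : proj u v (nseq k u) = nseq k false.
Proof. by elim: k => //= k IH; rewrite /proj /= eqxx -[in RHS]IH. Qed.

Lemma proj_pow k s :
  proj u v (flatten [seq nseq k x | x <- s]) =
  flatten [seq nseq k b | b <- proj u v s].
Proof.
elim: s => //= x s IH; rewrite proj_cat IH -[x :: s]cat1s (proj_cat [:: x]).
rewrite map_cat flatten_cat; congr (_ ++ _); rewrite /proj map_nseq /=.
by case: eqP => _; [|case: eqP => _]; rewrite /= ?cats0; elim: k {IH} => //= k ->.
Qed.

Lemma count_false_proj s : count_mem false (proj u v s) = count_mem u s.
Proof.
elim: s => //= x s IH; rewrite /proj /= count_cat -/(proj u v s) IH.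
by have [_|_] := eqVneq x u => //=; case: (x == v).
Qed.

Hypothesis uv : u != v.

Lemma proj_exchange s : proj v u s = exchange (proj u v s).
Proof.
rewrite /exchange /proj map_flatten -map_comp; congr flatten.
apply: eq_map => x /=; have [->|_] := eqVneq x u; first by rewrite (negPf uv).
by case: (x == v).
Qed.

Lemma proj_uniq s : uniq s -> u \in s -> v \in s ->
  proj u v s = [:: false; true] \/ proj u v s = [:: true; false].
Proof.
move=> + us; case/splitPr: us => s1 s2 sU vs.
(* [v] occurs once in [s], so exactly one of the parts before and after [u] contributes a single
   1. *)
have := count_uniq_mem v sU; rewrite vs count_cat /= (negPf uv) add0n.
have [us1 us2] : u \notin s1 /\ u \notin s2.
  move: sU; rewrite cat_uniq /= negb_or => /and3P[_ /andP[us1 _] /andP[us2 _]].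
  by split.
rewrite -cat1s !proj_cat (proj_nseq_l 1) !proj_notin_l //.
by case: count => [|[|a]]; case: count => [|[|b]] //= _; [left|right].
Qed.
End Projection.

(** * Complement languages, and passing from word length to bits *)

Lemma represents_setC (V : finType) (L : language) (P : seq V -> Prop) :
  (forall G : Defs.graph V, exists2 w, represents L w G & P w) ->
  forall G : Defs.graph V, exists2 w, represents (~` L) w G & P w.
Proof.
move=> rep G; pose e u v := (u != v) && ~~ adj G u v.
have e_sym : symmetric e by move=> u v; rewrite /e eq_sym adj_sym.
have e_irr : irreflexive e by move=> u; rewrite /e eqxx.
have [w [wV wE] Pw] := rep (Graph e_sym e_irr); exists w => //; split=> // u v.
have := wE u v; rewrite /word_adj /= /e; have [->|uv] /= := eqVneq u v.
  by rewrite adj_irr; split=> // -[].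
case: (adj G u v) => /= -[h1 h2]; split=> //.
- by split=> // /(conj isT)/h2.
- by case: (h1 isT) => _ Lw [_ /(_ Lw)].
Qed.

Lemma representable_quadratic (R : realType) (L : language) (C : nat) :
  (0 < C)%N ->
  (forall (V : finType) (G : Defs.graph V), exists2 w : seq V,
     represents L w G & (size w <= C * #|V| ^ 2)%N) ->
  graphs_representable_in_bits L (fun n : nat => n%:R ^+ 2 * ln n%:R : R).
Proof.
move=> C_gt0 rep; exists (fun n => C * n ^ 2 * up_log 2 n)%N; last first.
  by move=> V G _; have [w wG sw] := rep V G; exists w => //; exact: leq_mul.
(* The constant below comes from [up_log 2 n <= 2 * ln n / ln 2], valid for [n >= 2]. *)
have ln2_gt0 : 0 < ln 2 :> R by rewrite ln_gt0 // ltr1n.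
apply/eqO_exP; exists (C%:R * 2 / ln 2).
  by rewrite divr_gt0 // mulr_gt0 // ltr0n.
near=> n.
have n2 : (2 <= n)%N by near: n; exact: nbhs_infty_ge.
have ln_n : ln 2 <= ln n%:R :> R.
  by rewrite ler_ln ?posrE ?ltr0n ?ler_nat // (leq_trans _ n2).
have n_up : (up_log 2 n).-1%:R * ln 2 <= ln n%:R :> R.
  rewrite mulr_natl -lnXn // ler_ln ?posrE ?exprn_gt0 ?ltr0n //; last first.
    by rewrite (leq_trans _ n2).
  by rewrite -natrX ler_nat ltnW // up_log_gtn.
(* [up_log 2 n] exceeds the binary logarithm of [n] by at most 1, and that logarithm is itself at
   least 1. *)
have up : (up_log 2 n)%:R * ln 2 <= 2 * ln n%:R :> R.
  have : (0 < up_log 2 n)%N by rewrite up_log_gt0.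
  case: (up_log 2 n) n_up => // m /= n_up _.
  by rewrite -natr1 mulrDl mul1r [2 * _]mulr_natl mulr2n lerD.
have ln_ge0 : 0 <= ln n%:R :> R by rewrite (le_trans _ ln_n) // ltW.
rewrite !ger0_norm ?mulr_ge0 ?sqr_ge0 //.
rewrite !natrM -expr2.
rewrite [leRHS](_ : _ = C%:R * n%:R ^+ 2 * (2 * ln n%:R / ln 2)); last first.
  by field; rewrite lt0r_neq0.
by apply: ler_wpM2l; rewrite ?ler_pdivlMr // mulr_ge0 ?sqr_ge0.
Unshelve. all: by end_near.
Qed.

(** * Runs of zeros and binary Lyndon words *)

Section LyndonWords.
Implicit Types s t u : binword.

Lemma lex_le_cons a s b t :
  lex_le (a :: s) (b :: t) = (a < b)%O || ((a == b) && lex_le s t).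
Proof.
rewrite /lex_le [LHS]Order.SeqLexiOrder.lexi_cons.
by case: a b => [] [].
Qed.

Lemma lex_le_refl u : lex_le u u.
Proof. exact: (@lexx _ (seqlexi bool)). Qed.

(** At the first 1 of [t] the left word still has a 0, and before it the two agree. *)
Lemma lex_le_zeros k s t : has id (take k t) -> lex_le (nseq k false ++ s) t.
Proof. by elim: k t => [|k IH] [|[] t] //= /IH tk; rewrite lex_le_cons tk. Qed.

(* Equivalently, [s] has no factor [0^k] and, unless empty, ends with 1. *)
Definition ones_dense k s :=
  forall p, (p < size s)%N -> has id (take k (drop p s)).

Lemma has_take_cat k s t : has id (take k s) -> has id (take k (s ++ t)).
Proof.
by elim: s k => [|b s IH] [|k] //= /orP[->//|/IH ->]; rewrite orbT.
Qed.

(** A window starting in [s] meets a 1 before leaving [s], so no run of zeros crosses the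
    junction. *)
Lemma ones_dense_cat k s t :
  ones_dense k s -> ones_dense k t -> ones_dense k (s ++ t).
Proof.
move=> sk tk p; rewrite size_cat drop_cat; case: (ltnP p (size s)) => [ps _|sp pst].
  by apply: has_take_cat; apply: sk.
by apply: tk; rewrite ltn_subLR.
Qed.

Lemma ones_dense_flatten k (ss : seq binword) :
  (forall s, s \in ss -> ones_dense k s) -> ones_dense k (flatten ss).
Proof.
elim: ss => //= s ss IH ssk; apply: ones_dense_cat.
  by apply: ssk; rewrite mem_head.
by apply: IH => t tss; apply: ssk; rewrite inE tss orbT.
Qed.

(** A full window has [k] letters, too many to be all 0; a window cut off by the end contains the
    final 1. *)
Lemma ones_dense_count k s :
  (count_mem false (rcons s true) < k)%N -> ones_dense k (rcons s true).
Proof.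
move=> sk p; rewrite size_rcons ltnS => ps.
have [kd|dk] := ltnP (size (drop p (rcons s true))) k; last first.
  apply: contraLR sk => /hasPn z; rewrite -leqNgt.
  rewrite -(cat_take_drop p (rcons s true)) count_cat.
  rewrite -(cat_take_drop k (drop _ _)) count_cat addnCA.
  apply: leq_trans (leq_addr _ _); rewrite -[leqLHS](size_takel dk).
  by rewrite leq_eqVlt eq_sym -all_count; apply/orP; left; apply/allP => -[/z|].
rewrite take_oversize; last exact: ltnW.
by rewrite drop_rcons // has_rcons.
Qed.

(** The hypothesis has one 0 less because the proper suffixes of the word are the suffixes of its
    tail. Each nonempty one has a 1 among its first [k.+1] letters, so a rotation starting there is
    larger. *)
Lemma lyndon_criterion k s :
  ones_dense k.+1 (nseq k false ++ s) -> lyndon (nseq k.+1 false ++ s).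
Proof.
set u := nseq k.+1 false ++ s => dense.
have key x y : u = x ++ y -> x != [::] -> y != [::] -> has id (take k.+1 y).
  case: x => // b x [_ uE] _ y0; move: dense; rewrite uE => /(_ (size x)).
  by rewrite drop_size_cat // size_cat -[ltnLHS]addn0 ltn_add2l lt0n size_eq0; apply.
split=> [[x [k' [k2 uE]]]|_ [x [y [uE ->]]]].
  case: k' k2 uE => [|[|m]] // _ uE.
  have x0 : x != [::].
    by apply/eqP => xE; move: uE; rewrite xE /u /wpow; elim: (m.+2).
  (* [x] commutes with its powers, so the word is both [x ++ y] and [y ++ x]. As a proper suffix,
     [y] has an early 1; as a prefix, it forces that 1 into the leading zeros. *)
  pose y := wpow x m.+1.
  have uyx : u = y ++ x.
    rewrite uE /y /wpow.
    by elim: (m.+1) => [|n IH] /=; rewrite ?cats0 // -catA -IH.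
  have y0 : y != [::].
    by rewrite /y /wpow /= -size_eq0 size_cat addn_eq0 size_eq0 (negPf x0).
  have := has_take_cat x (key x y uE x0 y0).
  rewrite -uyx /u take_size_cat ?size_nseq //.
  by rewrite (@eq_in_has _ id pred0) ?has_pred0 // => b /nseqP[->].
have [x0|x0] := eqVneq x [::]; first by rewrite uE x0 cats0 lex_le_refl.
have [y0|y0] := eqVneq y [::]; first by rewrite uE y0 cats0 lex_le_refl.
exact/lex_le_zeros/has_take_cat/(key x y).
Qed.

Lemma exchangeK : involutive exchange.
Proof. by move=> s; rewrite /exchange -map_comp map_id_in // => b _ /=; case: b. Qed.

Lemma lyndon_language_exchange s :
  lyndon_language (exchange s) <-> lyndon_language s.
Proof.
suff imp t : lyndon_language t -> lyndon_language (exchange t).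
  by split=> /imp; rewrite ?exchangeK.
by case=> [tl|[t' t'l <-]]; [right; exists t|left; rewrite exchangeK].
Qed.

(** Rotating the longer run of zeros to the front gives a smaller conjugate. The exchanged word
    starts with 1 as [k > 0], and rotating its first 0 to the front makes it smaller too. *)
Lemma not_lyndon_language k s x y : (0 < k)%N ->
  nseq k false ++ true :: s = x ++ nseq k.+1 false ++ y ->
  ~ lyndon_language (nseq k false ++ true :: s).
Proof.
move=> k0 uE [[_ min]|[t [_ min] tE]].
  have /min : conjugate (nseq k false ++ true :: s) ((nseq k.+1 false ++ y) ++ x).
    by exists x, (nseq k.+1 false ++ y).
  by rewrite -addn1 nseqD -!catA /=; elim: k {k0 uE min} => //= k IH.
have {tE} tE : t = nseq k true ++ false :: exchange s.
  by rewrite -[t]exchangeK tE /exchange map_cat map_nseq.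
have /min : conjugate t ((false :: exchange s) ++ nseq k true).
  by exists (nseq k true), (false :: exchange s).
by rewrite tE; case: k k0 {uE tE}.
Qed.
End LyndonWords.

(** * Concatenations of blocks *)

Lemma eq_flatten_map (T I : eqType) (f g : I -> seq T) (s : seq I) :
  flatten [seq f i | i <- s] = flatten [seq g i | i <- s] ->
  (forall i, size (f i) = size (g i)) -> {in s, f =1 g}.
Proof.
move=> + fg; elim: s => //= j s IH /eqP.
rewrite eqseq_cat // => /andP[/eqP fgj /eqP/IH fgs] i.
by rewrite inE => /orP[/eqP->|/fgs].
Qed.

Lemma flatten_map_split (T I : eqType) (f : I -> seq T) (s : seq I) i :
  i \in s -> exists x y, flatten [seq f j | j <- s] = x ++ f i ++ y.
Proof.
case/splitPr => s1 s2; rewrite map_cat flatten_cat /=.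
by exists (flatten (map f s1)), (flatten (map f s2)).
Qed.

(** * Words encoding a graph *)

Section Representations.
Variables (V : finType) (G : Defs.graph V).
Implicit Types i u v : V.

Definition neighbors i := [seq j <- enum V | adj G i j].
(** Since [adj] is irreflexive, [i] has to be excluded explicitly; block [i] of [word_l] and
    [word_r] then contains [i] only once. *)
Definition far i := [seq j <- enum V | (j != i) && ~~ adj G i j].

Lemma far_notin i : i \notin far i.
Proof. by rewrite mem_filter eqxx. Qed.

Lemma neighbors_notin i : i \notin neighbors i.
Proof. by rewrite mem_filter adj_irr. Qed.

Lemma count_neighbors i v : count_mem v (neighbors i) = adj G i v.
Proof.
rewrite /neighbors count_uniq_mem; last exact/filter_uniq/enum_uniq.
by rewrite mem_filter mem_enum andbT.
Qed.

Lemma count_far i v : count_mem v (far i) = (v != i) && ~~ adj G i v.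
Proof.
rewrite /far count_uniq_mem; last exact/filter_uniq/enum_uniq.
by rewrite mem_filter mem_enum andbT.
Qed.

Lemma size_neighbors i : (size (neighbors i) < #|V|)%N.
Proof.
rewrite size_filter [ltnRHS]cardE -(count_predC (adj G i)) -[ltnLHS]addn0.
by rewrite ltn_add2l -has_count; apply/hasP; exists i; rewrite ?mem_enum //= adj_irr.
Qed.

Lemma size_far i : (size (far i) < #|V|)%N.
Proof.
rewrite size_filter [ltnRHS]cardE.
rewrite -(count_predC (fun j => (j != i) && ~~ adj G i j)) -[ltnLHS]addn0.
by rewrite ltn_add2l -has_count; apply/hasP; exists i; rewrite ?mem_enum //= eqxx.
Qed.

Lemma size_blocks (T : Type) k (f : V -> seq T) :
  (forall i, size (f i) <= k)%N ->
  (size (flatten [seq f i | i <- enum V]) <= #|V| * k)%N.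
Proof.
rewrite cardE => fk; elim: (enum V) => //= i s IH.
by rewrite size_cat mulSn leq_add.
Qed.

Definition word_l := flatten [seq i :: far i | i <- enum V].
Definition word_r := flatten [seq rcons (far i) i | i <- enum V].

Lemma mem_word_l i : i \in word_l.
Proof.
by apply/flattenP; exists (i :: far i); rewrite ?mem_head // map_f ?mem_enum.
Qed.

Lemma size_word_l : (size word_l <= #|V| ^ 2)%N.
Proof. by apply: size_blocks => i; exact: size_far. Qed.

Lemma size_word_r : (size word_r <= #|V| ^ 2)%N.
Proof. by apply: size_blocks => i; rewrite size_rcons size_far. Qed.

Lemma perm_word : perm_eq word_l word_r.
Proof.
rewrite /word_l /word_r; elim: (enum V) => //= i s IH.
by rewrite -cat_cons perm_cat // perm_sym perm_rcons.
Qed.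

(** Locates the middle of the projected word, where a palindrome or a copy is cut in two. *)
Lemma size_proj_word u v : size (proj u v word_l) = size (proj u v word_r).
Proof. by apply/perm_size/perm_flatten/perm_map/perm_word. Qed.

Lemma proj_word_eq u v : u != v ->
  proj u v word_l = proj u v word_r <-> adj G u v.
Proof.
move=> uv; rewrite !proj_flatten -!(map_comp (proj u v)); split=> [uvE|uv_adj].
  have szE i : size (proj u v (i :: far i)) = size (proj u v (rcons (far i) i)).
    by apply/perm_size/perm_flatten/perm_map; rewrite perm_sym perm_rcons.
  (* Block [u] alone decides: for non-adjacent [u] and [v] it projects to 01 on the left and to 10
     on the right. *)
  move: (eq_flatten_map uvE szE (mem_enum V u)) => /=.
  rewrite -cats1 -cat1s !proj_cat (proj_notin_l _ (far_notin u)) count_far.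
  by rewrite (proj_nseq_l u v 1) eq_sym uv; case: (adj G u v).
(* Under adjacency, block [u] projects to 0, block [v] to 1, and in any other block the letter [i]
   that changes place is erased. *)
congr flatten; apply: eq_map => i /=; rewrite -cats1 -cat1s !proj_cat.
have [->|iu] := eqVneq i u.
  by rewrite (proj_notin_l _ (far_notin u)) count_far uv_adj andbF cats0.
have [->|iv] := eqVneq i v.
  by rewrite (proj_notin_r u (far_notin v)) count_far adj_sym uv_adj andbF cats0.
by rewrite [proj u v [:: i]]/proj /= (negPf iu) (negPf iv) !cats0.
Qed.

Lemma palindromes_represent : represents palindromes (word_l ++ rev word_r) G.
Proof.
split=> [i|u v]; first by rewrite mem_cat mem_word_l.
rewrite /word_adj; have [->|uv] /= := eqVneq u v.
  by rewrite adj_irr; split=> // -[].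
rewrite -(proj_word_eq uv) /palindromes /= proj_cat proj_rev rev_cat revK.
split=> [E|[_ [_ /eqP]]]; last first.
  by rewrite eqseq_cat ?size_proj_word // => /andP[/eqP].
(* Palindromes are nonempty by definition; here each occurrence of [u] in [word_l] gives a 0. *)
split=> //; split=> [/(congr1 (count_mem false))|]; last by rewrite E.
rewrite count_cat count_false_proj // => /eqP.
by rewrite addn_eq0 => /andP[/eqP/count_memPn]; rewrite mem_word_l.
Qed.

Lemma copies_represent : represents copy_language (word_l ++ word_r) G.
Proof.
split=> [i|u v]; first by rewrite mem_cat mem_word_l.
rewrite /word_adj; have [->|uv] /= := eqVneq u v.
  by rewrite adj_irr; split=> // -[].
rewrite -(proj_word_eq uv) /copy_language /= proj_cat.
split=> [->|[_ [w _ wE]]]; first by split=> //; exists (proj u v word_r).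
(* Comparing doubled lengths shows that [w] is as long as either half. *)
have := congr1 size wE; rewrite !size_cat -size_proj_word !addnn.
move=> /double_inj sw; move/eqP: wE; rewrite eqseq_cat //.
by case/andP => /eqP <- /eqP.
Qed.

(** In the projection of block [u], a neighbour [v] separates the 3 zeros from the next 2, to which
    [enum V] adds one, so runs stay below 4. A non-neighbour comes only after all 5 zeros. The final
    [enum V] makes every block end with 1 when [u] precedes [v]. *)
Definition lyndon_block i :=
  nseq 3 i ++ neighbors i ++ nseq 2 i ++ far i ++ enum V.

Definition lyndon_word :=
  flatten [seq nseq 4 i | i <- enum V] ++ flatten [seq lyndon_block i | i <- enum V].

Lemma size_lyndon_word : (size lyndon_word <= 12 * #|V| ^ 2)%N.
Proof.
rewrite size_cat; set n := #|V|.
have h1 : (size (flatten [seq nseq 4 i | i <- enum V]) <= n * 4)%N.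
  by apply: size_blocks => i; rewrite size_nseq.
(* A block has 5 copies of [i] and three lists of at most [n] letters. The total [3 * n^2 + 9 * n]
   is at most [12 * n^2]. *)
have h2 : (size (flatten [seq lyndon_block i | i <- enum V]) <= n * (n * 3 + 5))%N.
  apply: size_blocks => i; rewrite !size_cat !size_nseq -cardE -/n.
  move: (size_far i) (size_neighbors i); rewrite -/n.
  by move: (size _) (size _) => a b; lia.
have n_sqr : (n <= n ^ 2)%N by case: (n) => // m; rewrite -mulnn leq_pmulr.
apply: leq_trans (leq_add h1 h2) _; move: n_sqr; rewrite -mulnn; nia.
Qed.

Lemma lyndon_word_represents : represents lyndon_language lyndon_word G.
Proof.
split=> [i|u v].
  rewrite mem_cat; apply/orP; left; apply/flattenP.
  by exists (nseq 4 i); rewrite ?mem_head // map_f ?mem_enum.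
(* If [v] comes first in [enum V], swapping [u] and [v] exchanges 0 and 1, which preserves both the
   language and adjacency. *)
wlog [uv uvE] : u v / u != v /\ proj u v (enum V) = [:: false; true].
  move=> wlog_uv; have [uv|uv] := eqVneq u v.
    by rewrite uv /word_adj eqxx adj_irr; split=> // -[].
  have [||uvE|uvE] := proj_uniq uv (enum_uniq V); rewrite ?mem_enum //.
    exact: wlog_uv.
  have := wlog_uv v u; rewrite eq_sym uv (proj_exchange uv) uvE.
  move=> /(_ (conj isT erefl)).
  rewrite adj_sym /word_adj eq_sym (proj_exchange uv) => ->.
  by split=> -[vu /lyndon_language_exchange].
rewrite /word_adj uv proj_cat proj_pow uvE proj_flatten -(map_comp (proj u v)).
have -> : flatten [seq nseq 4 b | b <- [:: false; true]] =
    nseq 4 false ++ nseq 4 true by [].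
rewrite -catA.
have dense0001 : ones_dense 4 [:: false; false; false; true].
  exact: (@ones_dense_count _ [:: false; false; false]).
have block_u : proj u v (lyndon_block u) =
    [:: false; false; false] ++ nseq (adj G u v) true ++ [:: false; false] ++
    nseq (~~ adj G u v) true ++ [:: false; true].
  rewrite !proj_cat uvE (proj_nseq_l u v 3) (proj_nseq_l u v 2).
  rewrite (proj_notin_l _ (far_notin u)) (proj_notin_l _ (neighbors_notin u)).
  by rewrite count_far count_neighbors eq_sym uv.
split=> [uv_adj|[_]].
  (* With one leading 0 removed, the prefix is 0001111, and it remains to exclude 0000 from each
     piece. *)
  split=> //; left; apply: lyndon_criterion; rewrite catA.
  apply: ones_dense_cat.
    exact: (@ones_dense_count _ [:: false; false; false; true; true; true]).
  apply: ones_dense_flatten => _ /mapP[i _ ->] /=.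
  have [->|iu] := eqVneq i u.
    by rewrite block_u uv_adj; exact: (ones_dense_cat dense0001 dense0001).
  have -> : proj u v (lyndon_block i) =
      rcons (proj u v (nseq 3 i ++ neighbors i ++ nseq 2 i ++ far i) ++
             [:: false]) true.
    by rewrite -cats1 -catA -[[:: false] ++ _]uvE -proj_cat -!catA.
  (* For [i != u], the vertex [u] lies in exactly one of [neighbors i] and [far i], and once in
     [enum V]: the block has only two zeros. *)
  apply: ones_dense_count; rewrite -cats1 2!count_cat count_false_proj !count_cat.
  rewrite !count_nseq count_neighbors count_far /= (negPf iu).
  by case: (adj G i u); case: (u != i).
apply: contraPT => uv_nadj.
have [x [y E]] := flatten_map_split (proj u v \o lyndon_block) (mem_enum V u).
(* The run 00000 opening block [u] is preceded by the prefix 00001111 and the earlier blocks [x]. *)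
apply: (@not_lyndon_language 4 _ (nseq 4 false ++ nseq 4 true ++ x) _ isT).
by rewrite E /= block_u (negPf uv_nadj).
Qed.

End Representations.

Theorem corollary30 (R : realType) (L : language)
    (hL : [\/ L = palindromes, L = copy_language | L = lyndon_language]) :
  graphs_representable_in_bits L (fun n : nat => n%:R ^+ 2 * ln n%:R : R) /\
  graphs_representable_in_bits (~` L) (fun n : nat => n%:R ^+ 2 * ln n%:R : R).
Proof.
(* The constant 12 is that of the Lyndon encoding; the other two need only [2 * #|V| ^ 2]
   letters. *)
suff rep (V : finType) (G : Defs.graph V) : exists2 w : seq V,
    represents L w G & (size w <= 12 * #|V| ^ 2)%N.
  split; apply: (@representable_quadratic _ _ 12) => // V.
  exact/represents_setC/rep.
have sl := size_word_l G; have sr := size_word_r G.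
case: hL => ->.
- exists (word_l G ++ rev (word_r G)); first exact: palindromes_represent.
  by rewrite size_cat size_rev (leq_trans (leq_add sl sr)) // addnn -mul2n leq_mul.
- exists (word_l G ++ word_r G); first exact: copies_represent.
  by rewrite size_cat (leq_trans (leq_add sl sr)) // addnn -mul2n leq_mul.
- exists (lyndon_word G); first exact: lyndon_word_represents.
  exact: size_lyndon_word.
Qed.
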